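(* Let $\mathcal R$ be the set of all records of $f_3$. The limit $$\kappa:=\lim_{n\to\infty}\frac{\#\{r : r\in\mathcal R,\ r\le n\}}{n}$$ exists, and $$\frac{3}{10}-\sum_{k=4}^{\infty}\frac{p_{k+1}-p_k}{2\,p_k\#}\ \le\ \kappa\ \le\ \frac{3}{10}-\sum_{k=4}^{\infty}\frac{1}{p_k\#}.$$
   Context: $\mathbb N=\{1,2,3,\dots\}$. $p_n$ denotes the $n$-th prime ($p_1=2$) and $p_n\#=\prod_{k=1}^n p_k$ is the $n$-th primorial number. The function $f_3:\mathbb N\to\mathbb N$ is defined recursively by $f_3(1)=1$, $f_3(2)=3$, and, for each $n\ge 3$, $f_3(n)$ is the smallest positive integer that is not in $\{f_3(1),\dots,f_3(n-1)\}$ and is coprime with $f_3(n-1)$. A turning point of $f_3$ is a natural number $t$ such that either (i) $t>3$ and $f_3(t)-f_3(t-1)>1$, or (ii) $t=3$ and $f_3(3)\neq\min(\mathbb N\setminus\{1,3\})$ (since $f_3(3)=2$, case (ii) does not occur). A record of $f_3$ is a value $f_3(t)$ where $t$ is a turning point of $f_3$. *)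

(* Defs.v *)
From HB Require Import structures.
From mathcomp Require Import all_boot all_order all_algebra.
From mathcomp Require Import all_classical all_reals all_analysis.

Set Implicit Arguments.
Unset Strict Implicit.
Unset Printing Implicit Defensive.

Definition least (P : nat -> Prop) (m : nat) : Prop :=
  P m /\ forall k, P k -> m <= k.

Lemma next_prime_ex m : exists p, prime p && (m < p).
Proof. by have [p mp pp] := prime_above m; exists p; rewrite pp. Qed.

Definition next_prime (m : nat) : nat := ex_minn (next_prime_ex m).

(* 1-indexed, so that nth_prime 1 = 2; nth_prime 0 = 0 is a junk value *)
Definition nth_prime (n : nat) : nat := iter n next_prime 0.

Definition primorial (n : nat) : nat := \prod_(1 <= k < n.+1) nth_prime k.

Lemma nth_primeS n : least (fun p => prime p && (nth_prime n < p)) (nth_prime n.+1).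
Proof.
by rewrite /nth_prime iterS /next_prime; case: ex_minnP => p Pp minp; split.
Qed.

(* s lists f3 (n-1), ..., f3 1, most recent first *)
Definition candidate (s : seq nat) (m : nat) : bool :=
  [&& 0 < m, m \notin s & coprime m (head 0 s)].

(* head 0 s * (sumn s).+1 + 1 is a candidate when s consists of positive
   numbers, so the bounded search for the least candidate succeeds *)
Definition next_f3 (s : seq nat) : nat :=
  find (candidate s) (iota 0 (head 0 s * (sumn s).+1).+2).

Fixpoint f3_hist (n : nat) : seq nat :=
  match n with
  | 0 => [::]
  | 1 => [:: 1]
  | 2 => [:: 3; 1]
  | m.+1 => let s := f3_hist m in next_f3 s :: s
  end.

(* f3 0 = 0 is a junk value: the sequence starts at index 1 *)
Definition f3 (n : nat) : nat := head 0 (f3_hist n).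

Lemma f3_1 : f3 1 = 1. Proof. by []. Qed.
Lemma f3_2 : f3 2 = 3. Proof. by []. Qed.

Lemma f3_histE n : f3_hist n = rev [seq f3 i | i <- iota 1 n].
Proof.
elim: n => [//|n IHn].
by rewrite -(addn1 n) iotaD map_cat rev_cat -IHn addn1 add1n;
  case: n {IHn} => [|[|n]].
Qed.

Lemma next_f3_least s : 0 < head 0 s -> all (leq 1) s ->
  least (candidate s) (next_f3 s).
Proof.
case: s => [//|a s] /= a0 /andP[_ sp]; rewrite /next_f3.
set b := (_ * _).+1; set P := candidate _.
have Pb : P b.
  apply/and3P; split=> //.
    apply/negP => bin.
    have le_sumn (t : seq nat) x : x \in t -> x <= sumn t.
      elim: t => //= y t IH; rewrite inE => /orP[/eqP ->|/IH xt].
        exact: leq_addr.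
      exact: leq_trans xt (leq_addl _ _).
    have := le_sumn _ _ bin; rewrite /b leqNgt ltnS => /negP; apply.
    by apply: leq_trans (leqnSn _) _; rewrite leq_pmull.
  by rewrite /b /= -addn1 mulnC /coprime gcdnC gcdnMDl gcdn1.
have hasP : has P (iota 0 b.+1).
  by apply/hasP; exists b => //; rewrite mem_iota /=.
have ltf : find P (iota 0 b.+1) < b.+1.
  by rewrite -[X in _ < X](size_iota 0) -has_find.
split; first by have := nth_find 0 hasP; rewrite nth_iota.
move=> k Pk; rewrite leqNgt; apply/negP => kf.
have := before_find 0 kf.
by rewrite nth_iota ?add0n ?Pk //; apply: ltn_trans kf ltf.
Qed.

Lemma f3_hist_gt0 n : all (leq 1) (f3_hist n).
Proof. by elim: n => [//|n]; case: n => [|[|n]]. Qed.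

Lemma f3_rec n : 3 <= n ->
  least (fun m => [/\ 0 < m, (forall i, 1 <= i < n -> m <> f3 i)
                    & coprime m (f3 n.-1)])
        (f3 n).
Proof.
case: n => [|[|[|n]]] // _; rewrite /=.
set s := f3_hist n.+2; have sp : all (leq 1) s := f3_hist_gt0 _.
have s0 : 0 < head 0 s.
  have : s != [::] by rewrite /s f3_histE -size_eq0 size_rev size_map size_iota.
  by case: s sp => [//|a s] /= /andP[].
have -> : f3 n.+3 = next_f3 s by [].
have -> : f3 n.+2 = head 0 s by [].
have cP m : candidate s m <->
    [/\ 0 < m, (forall i, 1 <= i < n.+3 -> m <> f3 i) & coprime m (head 0 s)].
  rewrite /candidate; split.
    move=> /and3P[m0 ms mc]; split=> // i ilt mE; move/negP: ms; apply.
    rewrite /s f3_histE mem_rev mE; apply: map_f.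
    by rewrite mem_iota add1n.
  move=> [m0 ms mc]; apply/and3P; split=> //; apply/negP.
  rewrite /s f3_histE mem_rev => /mapP[i]; rewrite mem_iota add1n.
  exact: ms.
have [Ps mins] := next_f3_least s0 sp.
by split; [apply/cP | move=> k /cP/mins].
Qed.

(* truncated subtraction is harmless in a comparison with 1 *)
Definition turning_point (t : nat) : Prop :=
  (3 < t /\ 1 < f3 t - f3 t.-1) \/
  (t = 3 /\ ~ least (fun m => [/\ 0 < m, m <> 1 & m <> 3]) (f3 3)).

Definition records : set nat := [set f3 t | t in turning_point]%classic.

Definition record_count (n : nat) : nat :=
  #|[pred r : 'I_n.+1 | (r : nat) \in records]|.

(* Main.v *)
Require Import Defs.
From HB Require Import structures.
From mathcomp Require Import all_boot all_order all_algebra.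
From mathcomp Require Import all_classical all_reals all_analysis.
From mathcomp Require Import zify ring lra.
Import Order.TTheory GRing.Theory Num.Theory.
Import numFieldNormedType.Exports.
Local Open Scope classical_set_scope.
Local Open Scope ring_scope.

(** The sequence climbs in a rigid pattern.  Suppose that an even [m] has just
    been reached and that the values used so far are exactly 1, ..., m + 1.
    The next value is [m + q], where [q] is the least prime not dividing [m];
    after that the sequence fills the hole m + 2, ..., m + q - 1 in increasing
    order, and the same situation recurs at [m + q - 1].  So the records are the
    numbers [z + 1], where [z > 2] runs over the orbit of 2 under the jump map
    [m |-> m + q - 1] ([recordsE]).

    A jump of any positive number cannot pass over a point of this orbit
    ([jump_no_cross]), so the orbit is the set of all [z > 1] that no jump of
    a smaller positive number passes over; call such [z] landings.  As the jump
    of [m] has length [p_(j+1) - 1] when [p_j#] divides [m] but [p_(j+1)] does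
    not, a landing is a number that avoids, for every [j], the first
    [p_(j+1) - 2] integers after each positive multiple of [p_j#].  This is a
    sieve.

    Let [d_k] be the density of the periodic set obtained by imposing the
    condition for [j <= k] only.  A count gives [d_3 = 9/30].  Within a period
    [p_(k+1)#] the condition of level [k + 1] removes only even numbers from
    p_(k+1) - 1, ..., p_(k+2) - 2, and it does remove the first of
    these.  Hence [1 / p_(k+1)# <= d_k - d_(k+1)], and the difference is at most
    [(p_(k+2) - p_(k+1)) / (2 p_(k+1)#)] ([density_step]); summing these
    estimates over [k >= 3] yields the two series.

    The levels above [k] remove a proportion at most
    [\sum_(j > k) p_(j+1) / p_j#] of the integers, uniformly in the bound up to
    which one counts.  This tail tends to 0 because
    [p_(j+1) <= 2 p_(j-2)# + 1], which follows from the three pairwise coprime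
    numbers [Q - 1], [Q + 1], [2 Q + 1] for [Q = p_(j-2)#]
    ([nth_prime_le_primorial]).  So the records have a density, namely the limit
    of the decreasing sequence [d_k] ([record_count_approx],
    [cvg_by_approx]). *)

Section Records.
Local Open Scope nat_scope.
Implicit Types (i j k l m n p v z a b : nat) (P Q : pred nat).

(** * Primes and primorials *)

Lemma nth_prime_prime i : prime (nth_prime i.+1).
Proof. by have [/andP[]] := nth_primeS i. Qed.

Lemma nth_prime_ltS i : nth_prime i < nth_prime i.+1.
Proof. by have [/andP[]] := nth_primeS i. Qed.

Lemma nth_prime_minimal i p : prime p -> nth_prime i < p -> nth_prime i.+1 <= p.
Proof. by move=> pp ip; have [_] := nth_primeS i; apply; rewrite pp. Qed.

Lemma nth_prime_lt i j : i < j -> nth_prime i < nth_prime j.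
Proof. by move: i j; apply: (homo_ltn ltn_trans); exact: nth_prime_ltS. Qed.

Lemma nth_prime_le i j : i <= j -> nth_prime i <= nth_prime j.
Proof. by rewrite leq_eqVlt => /predU1P[-> //|/nth_prime_lt/ltnW]. Qed.

Lemma nth_prime_ge i : i <= nth_prime i.
Proof. by elim: i => // i IH; apply: leq_ltn_trans IH (nth_prime_ltS i). Qed.

Lemma nth_prime_surj p : prime p -> exists i, p = nth_prime i.+1.
Proof.
move=> pp; have ex : exists i, p <= nth_prime i.+1.
  by exists p; apply: leq_trans (nth_prime_ge _).
exists (ex_minn ex); case: ex_minnP => i ple mini.
apply/eqP; rewrite eqn_leq ple nth_prime_minimal //.
case: i mini {ple} => [|i] mini; first exact: prime_gt0.
by rewrite ltnNge; apply/negP => /mini; rewrite ltnn.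
Qed.

Lemma nth_prime_unique i p : prime p -> nth_prime i < p ->
  (forall l, nth_prime i < l < p -> ~~ prime l) -> nth_prime i.+1 = p.
Proof.
move=> pp ip gap; apply/eqP; rewrite eqn_leq nth_prime_minimal //= leqNgt.
by apply/negP => lt; have := gap (nth_prime i.+1);
  rewrite nth_prime_ltS lt nth_prime_prime => /(_ isT).
Qed.

Lemma nth_prime_1234 :
  [/\ nth_prime 1 = 2, nth_prime 2 = 3, nth_prime 3 = 5 & nth_prime 4 = 7].
Proof.
have p1 : nth_prime 1 = 2 by apply: nth_prime_unique => // -[|[|l]].
have p2 : nth_prime 2 = 3.
  by apply: nth_prime_unique; rewrite ?p1 // => -[|[|[|l]]].
have p3 : nth_prime 3 = 5.
  by apply: nth_prime_unique; rewrite ?p2 // => -[|[|[|[|[|l]]]]].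
split=> //; apply: nth_prime_unique; rewrite ?p3 //.
by case=> [|[|[|[|[|[|[|l]]]]]]].
Qed.

Lemma primorial0 : primorial 0 = 1.
Proof. by rewrite /primorial big_geq. Qed.

Lemma primorialS k : primorial k.+1 = primorial k * nth_prime k.+1.
Proof. by rewrite /primorial big_nat_recr. Qed.

Lemma primorial_123 :
  [/\ primorial 1 = 2, primorial 2 = 6 & primorial 3 = 30].
Proof.
by have [p1 p2 p3 _] := nth_prime_1234; rewrite !primorialS primorial0 p1 p2 p3.
Qed.

Lemma primorial_gt0 k : 0 < primorial k.
Proof.
elim: k => [|k IH]; first by rewrite primorial0.
by rewrite primorialS muln_gt0 IH prime_gt0 ?nth_prime_prime.
Qed.

Lemma primorial_ge k : k < primorial k.
Proof.
elim: k => [|k IH]; first by rewrite primorial0.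
rewrite primorialS; apply: leq_ltn_trans IH _.
by rewrite ltn_Pmulr ?primorial_gt0 ?prime_gt1 ?nth_prime_prime.
Qed.

Lemma dvdn_primorial i j : i <= j -> primorial i %| primorial j.
Proof.
move=> /subnKC <-; elim: (j - i) => [|d IH]; first by rewrite addn0.
by rewrite addnS primorialS dvdn_mulr.
Qed.

Lemma primorial_le i j : i <= j -> primorial i <= primorial j.
Proof. by move=> /dvdn_primorial/dvdn_leq; apply; apply: primorial_gt0. Qed.

Lemma nth_prime_dvd_primorial i k : i < k -> nth_prime i.+1 %| primorial k.
Proof.
by move=> /dvdn_primorial; apply: dvdn_trans; rewrite primorialS dvdn_mull.
Qed.

Lemma prime_dvd_primorial k p :
  prime p -> p < nth_prime k.+1 -> p %| primorial k.
Proof.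
move=> /nth_prime_surj[i ->] lt; apply: nth_prime_dvd_primorial.
by rewrite ltnNge; apply: contraL lt => ki; rewrite -leqNgt nth_prime_le.
Qed.

Lemma prime_dvd_primorial_le k p :
  prime p -> p %| primorial k -> p <= nth_prime k.
Proof.
move=> pp; elim: k => [|k IH].
  by rewrite primorial0 dvdn1 => /eqP p1; move: pp; rewrite p1.
rewrite primorialS Euclid_dvdM // => /orP[/IH h|].
  exact: leq_trans h (ltnW (nth_prime_ltS k)).
by apply: dvdn_leq; apply/prime_gt0/nth_prime_prime.
Qed.

Lemma primorial_dvd k m :
  (forall i, i < k -> nth_prime i.+1 %| m) -> primorial k %| m.
Proof.
elim: k => [|k IH] pm; first by rewrite primorial0 dvd1n.
rewrite primorialS Gauss_dvd ?pm ?IH //; first by move=> i ik; apply/pm/ltnW.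
rewrite coprime_sym prime_coprime ?nth_prime_prime //; apply/negP.
move/(prime_dvd_primorial_le _ _ (nth_prime_prime k)).
by rewrite leqNgt nth_prime_ltS.
Qed.

(** Distinct primes above the [i]-th one push the primes indexed
    i + 1, ..., i + size s below any common upper bound. *)
Lemma nth_prime_le_of_primes i (s : seq nat) x : uniq s -> nth_prime i <= x ->
  all (fun p => [&& prime p, nth_prime i < p & p <= x]) s ->
  nth_prime (i + size s) <= x.
Proof.
move: {2}(size s) (erefl (size s)) => n.
elim: n s i => [|n IH] s i sn us ix /allP sP; first by rewrite sn addn0.
have pi1x : nth_prime i.+1 <= x.
  case: s sn {us} sP => [//|p s] _ /(_ p); rewrite mem_head => /(_ isT).
  by case/and3P => pp ip; apply: leq_trans; apply: nth_prime_minimal.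
pose s' := rem (nth_prime i.+1) s.
have ss' : {subset s' <= s} by exact: mem_rem.
pose t := take n s'.
have st : size t = n.
  rewrite size_takel // /s'; case: (boolP (nth_prime i.+1 \in s)) => ps.
    by rewrite size_rem // sn.
  by rewrite rem_id // sn.
rewrite sn addnS -addSn -st; apply: IH => //.
  by rewrite take_uniq // rem_uniq.
apply/allP => p /mem_take ps'; have /sP/and3P[pp ip ->] := ss' _ ps'.
rewrite pp andbT /= ltn_neqAle nth_prime_minimal // andbT.
by apply: contraTneq ps' => <-; rewrite mem_rem_uniq // inE eqxx.
Qed.

Lemma prime_factor_gt k a :
  1 < a -> coprime a (primorial k) -> nth_prime k < pdiv a.
Proof.
move=> a1 co; rewrite ltnNge; apply/negP => le.
have pp := pdiv_prime a1.
have : pdiv a %| primorial k.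
  by apply: prime_dvd_primorial => //; apply: leq_ltn_trans le (nth_prime_ltS k).
move=> pk; have : pdiv a %| gcdn a (primorial k) by rewrite dvdn_gcd pdiv_dvd.
by rewrite (eqP co) dvdn1 => /eqP p1; rewrite p1 in pp.
Qed.

Lemma pdiv_coprime_neq a b : 1 < a -> coprime a b -> pdiv a != pdiv b.
Proof.
move=> a1 co; apply/eqP => E; have pp := pdiv_prime a1.
have : pdiv a %| gcdn a b by rewrite dvdn_gcd pdiv_dvd E pdiv_dvd.
by rewrite (eqP co) dvdn1 => /eqP p1; rewrite p1 in pp.
Qed.

(** A weak form of Bertrand's postulate.  For [Q = p_k#] the numbers [Q - 1],
    [Q + 1] and [2 * Q + 1] are coprime to [Q] and, since 6 divides [Q], to each
    other; their least prime factors are three distinct primes beyond [p_k]. *)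
Lemma nth_prime_le_primorial k : 1 < k -> nth_prime k.+3 <= 2 * primorial k + 1.
Proof.
move=> k1; have pkQ : nth_prime k <= primorial k.
  case: k k1 => // k _; apply: dvdn_leq (primorial_gt0 _) _.
  exact: nth_prime_dvd_primorial.
set Q := primorial k.
have Q6 : 6 <= Q by have [_ <- _] := primorial_123; apply: primorial_le.
have d2 : 2 %| Q.
  by have [<- _ _] := primorial_123; apply: dvdn_primorial; apply: ltnW.
have d3 : 3 %| Q.
  by apply: (@dvdn_trans (primorial 2)); rewrite ?dvdn_primorial //;
    have [_ -> _] := primorial_123.
have co1 : coprime (Q + 1) Q by rewrite addnC /coprime gcdnC gcdnDr gcdn1.
have co2 : coprime (2 * Q + 1) Q.
  by rewrite /coprime gcdnC gcdnMDl gcdn1.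
have coM : coprime (Q - 1) Q.
  by have := coprimenS (Q - 1); rewrite (_ : (Q - 1).+1 = Q) //; lia.
have c1 : coprime (Q - 1) (Q + 1).
  have -> : Q + 1 = 2 + (Q - 1) by lia.
  rewrite /coprime gcdnDr -/(coprime _ _) coprime_sym prime_coprime //.
  by rewrite dvdn_subr //; lia.
have c2 : coprime (Q - 1) (2 * Q + 1).
  have -> : 2 * Q + 1 = 2 * (Q - 1) + 3 by lia.
  rewrite /coprime gcdnMDl -/(coprime _ _) coprime_sym prime_coprime //.
  by rewrite dvdn_subr //; lia.
have c3 : coprime (Q + 1) (2 * Q + 1).
  have -> : 2 * Q + 1 = 1 * (Q + 1) + Q by lia.
  by rewrite /coprime gcdnMDl.
have := @nth_prime_le_of_primes k
  [:: pdiv (Q - 1); pdiv (Q + 1); pdiv (2 * Q + 1)] (2 * Q + 1).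
rewrite /= addn3; apply.
- by rewrite !inE negb_or !pdiv_coprime_neq //; lia.
- by rewrite -/Q in pkQ; lia.
- rewrite !pdiv_prime ?prime_factor_gt //=; try lia.
  apply/and4P; split=> //.
  + by apply: leq_trans (pdiv_leq _) _; lia.
  + by apply: leq_trans (pdiv_leq _) _; lia.
  + by apply: pdiv_leq; lia.
Qed.

(** * The jump map and the numbers it never passes over *)

(** The guard [0 < m] makes the search total; the value at 0 is junk. *)
Lemma gap_index_ex m : exists j, (0 < m) ==> ~~ (nth_prime j.+1 %| m).
Proof.
exists m; apply/implyP => m0; apply/negP => /(dvdn_leq m0).
by rewrite leqNgt nth_prime_ge.
Qed.

Definition gap_index m := ex_minn (gap_index_ex m).
Definition gap_prime m := nth_prime (gap_index m).+1.
Definition jump m := (m + gap_prime m).-1.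

Lemma gap_prime_prime m : prime (gap_prime m).
Proof. exact: nth_prime_prime. Qed.

Lemma jumpK m : (jump m).+1 = m + gap_prime m.
Proof. by rewrite /jump prednK // ltn_addl // prime_gt0 // gap_prime_prime. Qed.

Lemma gap_primeN_dvd m : 0 < m -> ~~ (gap_prime m %| m).
Proof.
by move=> m0; rewrite /gap_prime /gap_index; case: ex_minnP => j; rewrite m0.
Qed.

Lemma primorial_gap_index m : primorial (gap_index m) %| m.
Proof.
case: (posnP m) => [->|m0]; first exact: dvdn0.
apply: primorial_dvd => i; rewrite /gap_index; case: ex_minnP => j _ minj ij.
by apply: contraTT ij => nd; rewrite -leqNgt; apply: minj; rewrite m0.
Qed.

Lemma prime_lt_gap_prime m p : prime p -> p < gap_prime m -> p %| m.
Proof.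
move=> pp /(prime_dvd_primorial _ _ pp) /dvdn_trans; apply.
exact: primorial_gap_index.
Qed.

Lemma gap_prime_le m d : 1 < d -> coprime d m -> gap_prime m <= d.
Proof.
move=> d1 co; apply: leq_trans (pdiv_leq (ltnW d1)).
apply: nth_prime_minimal (pdiv_prime d1) (prime_factor_gt _ _ d1 _).
by rewrite (coprime_dvdr (primorial_gap_index m) co).
Qed.

Lemma coprime_gap_prime m : 0 < m -> coprime (gap_prime m) m.
Proof. by move=> m0; rewrite prime_coprime ?gap_prime_prime ?gap_primeN_dvd. Qed.

Lemma primorial_dvd_gap_prime j m :
  0 < m -> primorial j %| m -> nth_prime j.+1 <= gap_prime m.
Proof.
move=> m0 jm; rewrite nth_prime_le // ltnS leqNgt; apply/negP => lt.
have /negP := gap_primeN_dvd m m0; apply.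
by apply: dvdn_trans jm; apply: nth_prime_dvd_primorial.
Qed.

Lemma ltn_jump m : m < jump m.
Proof. by have := prime_gt1 (gap_prime_prime m); have := jumpK m; lia. Qed.

(** If the jump of [m] went beyond [jump z], then [d = z + gap_prime z - m]
    would satisfy [1 < d < gap_prime m].  A prime factor of [d] would then divide
    [m], hence [z + gap_prime z]; being smaller than [gap_prime z] it would also
    divide [z], hence the prime [gap_prime z], which is absurd. *)
Lemma jump_no_cross z m : 0 < z -> z < m -> m < jump z -> jump m <= jump z.
Proof.
move=> z0 zm; rewrite -ltnS jumpK => zq; rewrite leqNgt; apply/negP.
rewrite -ltnS !jumpK => lt.
set d := z + gap_prime z - m.
have d1 : 1 < d by rewrite /d; lia.
have pp := pdiv_prime d1.
have pm : pdiv d %| m.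
  apply: prime_lt_gap_prime => //; apply: leq_ltn_trans (pdiv_leq (ltnW d1)) _.
  by rewrite /d; lia.
have ltq : pdiv d < gap_prime z.
  by apply: leq_ltn_trans (pdiv_leq (ltnW d1)) _; rewrite /d; lia.
have pz : pdiv d %| z by apply: prime_lt_gap_prime.
have : pdiv d %| z + gap_prime z.
  rewrite (_ : z + gap_prime z = d + m); last by rewrite /d; lia.
  by rewrite dvdn_add ?pdiv_dvd.
rewrite dvdn_addr // dvdn_prime2 ?gap_prime_prime // => /eqP E.
by rewrite E ltnn in ltq.
Qed.

(** The orbit of 2 under [jump], described without iteration: this form turns
    the counting of records into a sieve problem. *)
Definition landing z := (1 < z) && [forall m : 'I_z, (0 < m) ==> (jump m <= z)].

Lemma landingP z :
  reflect (1 < z /\ forall m, 0 < m -> m < z -> jump m <= z) (landing z).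
Proof.
apply: (iffP andP) => -[z1 h]; split=> //.
  by move=> m m0 mz; have /forallP/(_ (Ordinal mz))/implyP := h; apply.
by apply/forallP => m; apply/implyP => m0; apply: h.
Qed.

Lemma landing_jump z : landing z -> landing (jump z).
Proof.
move=> /landingP[z1 h]; have zj := ltn_jump z; apply/landingP; split; first lia.
move=> m m0 mj; have [mz|mz|->//] := ltngtP m z.
  exact: leq_trans (h _ m0 mz) (ltnW zj).
by apply: jump_no_cross => //; lia.
Qed.

Lemma gap_prime_odd m : odd m -> gap_prime m = 2.
Proof.
move=> om; apply/eqP; rewrite eqn_leq prime_gt1 ?gap_prime_prime // andbT.
by apply: gap_prime_le => //; rewrite coprime2n.
Qed.

Lemma gap_prime_even m : 0 < m -> ~~ odd m -> 2 < gap_prime m.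
Proof.
move=> m0 em; rewrite ltn_neqAle prime_gt1 ?gap_prime_prime // andbT.
by apply: contra em => /eqP E; have := gap_primeN_dvd m m0; rewrite -E dvdn2 negbK.
Qed.

Lemma landing_even z : landing z -> ~~ odd z.
Proof.
move=> /landingP[z1 h]; apply/negP => oz.
have lt : z.-1 < z by lia.
(* An odd landing would be passed over by the jump of the even [z - 1]. *)
have := h z.-1 ltac:(lia) lt; have := jumpK z.-1.
have := gap_prime_even z.-1 ltac:(lia); lia.
Qed.

Lemma gap_prime2 : gap_prime 2 = 3.
Proof.
apply/eqP; rewrite eqn_leq gap_prime_le //=.
exact: gap_prime_even.
Qed.

Lemma jump2 : jump 2 = 4.
Proof. by rewrite /jump gap_prime2. Qed.

Lemma landing2 : landing 2.
Proof.
apply/landingP; split=> // m m0 m2; have -> : m = 1 by lia.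
by rewrite /jump gap_prime_odd.
Qed.

(** * From the sequence to its records *)

Definition used n v : Prop := exists2 i, 1 <= i <= n & f3 i = v.

Lemma usedS n v : used n.+1 v <-> used n v \/ v = f3 n.+1.
Proof.
split=> [[i /andP[i1]]|[[i /andP[i1 iN]] E|->]].
- rewrite leq_eqVlt => /predU1P[-> <-|]; first by right.
  by rewrite ltnS => iN E; left; exists i; rewrite ?i1.
- by exists i; rewrite // i1 ltnW.
- by exists n.+1; rewrite //= leqnn.
Qed.

Lemma f3_eq n v : 1 < n -> 0 < v -> ~ used n v -> coprime v (f3 n) ->
  (forall w, 0 < w -> ~ used n w -> coprime w (f3 n) -> v <= w) -> f3 n.+1 = v.
Proof.
move=> n1 v0 nu co minv.
have [[f0 fu fco] minf] := f3_rec (n := n.+1) n1.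
apply/eqP; rewrite eqn_leq; apply/andP; split.
  apply: minf; split=> // i iN E; apply: nu; exists i => //.
apply: minv => // -[i iN E]; apply: (fu i) => //.
Qed.

(** The recurring state of the sequence: it has reached [m], and all the values
    up to [m + 1], but no others, have been used. *)
Definition filled m : Prop :=
  f3 m.+1 = m /\ forall v, 0 < v -> used m.+1 v <-> v <= m.+1.

Lemma filled2 : filled 2.
Proof.
split=> // v v0; split=> [[i iN <-]|v3].
  by case: i iN => [|[|[|[|i]]]].
case: v v0 v3 => [|[|[|[|v]]]] // _ _.
- by exists 1.
- by exists 3.
- by exists 2.
Qed.

Section Step.
Variable m : nat.
Hypotheses (m1 : 1 < m) (me : ~~ odd m) (fm : filled m).
Let q := gap_prime m.

(** The candidates exceed [m + 1], so they are the [m + d] with [d > 1] coprime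
    to [m], and the least such [d] is the least prime not dividing [m]. *)
Lemma f3_record : f3 m.+2 = m + q.
Proof.
have [fE us] := fm; have q2 : 2 < q by apply: gap_prime_even => //; lia.
apply: f3_eq; [lia|lia| | |].
- by rewrite us; lia.
- by rewrite fE coprime_sym /coprime gcdnDl gcdnC; apply: coprime_gap_prime; lia.
- move=> w w0; rewrite us // fE => nu co.
  have mw : m <= w by lia.
  rewrite -(subnKC mw) leq_add2l; apply: gap_prime_le; first lia.
  by move: co; rewrite -{1}(subnKC mw) coprime_sym /coprime gcdnDl gcdnC.
Qed.

(** After the record the sequence counts through the hole that the record has
    left.  Consecutive integers are coprime, so only the first step, from [m + q]
    down to [m + 2], needs an argument: a common prime factor would divide
    [q - 2], hence be smaller than [q] and divide [m], hence divide 2, although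
    [q - 2] is odd. *)
Lemma f3_fill i : i.+3 <= q ->
  f3 (m + i.+3) = m + i.+2 /\
  forall v, 0 < v -> used (m + i.+3) v <-> v <= m + i.+2 \/ v = m + q.
Proof.
have [fE us] := fm; have q2 : 2 < q by apply: gap_prime_even => //; lia.
have step j : j < q ->
    (forall v, 0 < v -> used (m + j.+2) v <-> v <= m + j.+1 \/ v = m + q) ->
    coprime (m + j.+2) (f3 (m + j.+2)) -> j.+2 < q ->
    f3 (m + j.+3) = m + j.+2.
  move=> jq usj co jq2; rewrite addnS; apply: f3_eq; [lia|lia| |by []|].
    by rewrite usj; lia.
  by move=> w w0; rewrite usj // => nu _; lia.
have usS j : f3 (m + j.+3) = m + j.+2 ->
    (forall v, 0 < v -> used (m + j.+2) v <-> v <= m + j.+1 \/ v = m + q) ->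
    forall v, 0 < v -> used (m + j.+3) v <-> v <= m + j.+2 \/ v = m + q.
  move=> fj usj v v0; rewrite addnS usedS usj // -addnS fj.
  by split; lia.
elim: i => [|i IH] iq.
  (* The state right after the record, written in the form that persists. *)
  have us0 v : 0 < v -> used (m + 2) v <-> v <= m + 1 \/ v = m + q.
    by move=> v0; rewrite addn2 usedS us // f3_record addn1.
  suff f0 : f3 (m + 3) = m + 2 by split=> //; apply: usS.
  apply: step => //; first lia.
  rewrite addn2 f3_record; apply/negPn/negP => nco.
  have g1 : 1 < gcdn m.+2 (m + q).
    by move: nco; rewrite /coprime; have := gcdn_gt0 m.+2 (m + q); lia.
  set p := pdiv (gcdn m.+2 (m + q)).
  have pp : prime p := pdiv_prime g1.
  have pm2 : p %| m + 2.
    by rewrite addn2; apply: dvdn_trans (pdiv_dvd _) (dvdn_gcdl _ _).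
  have pmq : p %| m + q by apply: dvdn_trans (pdiv_dvd _) (dvdn_gcdr _ _).
  have oq : odd q.
    by case: (even_prime (gap_prime_prime m)) => //; rewrite -/q; lia.
  have pq : p %| q - 2.
    by rewrite (_ : q - 2 = (m + q) - (m + 2)) ?dvdn_sub //; lia.
  have ple : p <= q - 2 by apply: dvdn_leq => //; lia.
  have pm : p %| m by apply: prime_lt_gap_prime => //; rewrite -/q; lia.
  have : p %| 2 by rewrite -(dvdn_addr _ pm).
  rewrite dvdn_prime2 // => /eqP E; move: pq; rewrite E dvdn2; lia.
have [fi usi] := IH (ltnW iq).
suff fi1 : f3 (m + i.+4) = m + i.+3 by split=> //; apply: usS.
apply: step => //; try lia.
by rewrite fi addnS coprimeSn.
Qed.

Lemma filled_jump : filled (jump m).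
Proof.
have [fE us] := fm; have q2 : 2 < q by apply: gap_prime_even => //; lia.
(* The last value of the hole is [m + q - 1], reached at index [m + q]. *)
have [] := f3_fill (q - 3) ltac:(lia).
have -> : m + (q - 3).+3 = (jump m).+1 by rewrite jumpK -/q; lia.
have E : m + (q - 3).+2 = jump m by apply: succn_inj; rewrite jumpK -/q; lia.
rewrite E => fj usj; split=> // v v0; rewrite usj // jumpK -/q.
have := jumpK m; rewrite -/q; split; lia.
Qed.

Lemma turning_point_step t :
  m.+2 <= t <= (jump m).+1 -> 1 < f3 t - f3 t.-1 <-> t = m.+2.
Proof.
have [fE us] := fm; have q2 : 2 < q by apply: gap_prime_even => //; lia.
rewrite jumpK -/q => tm; split=> [|->]; last by rewrite f3_record /= fE; lia.
have [->//|tm2] := eqVneq t m.+2.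
have [fi _] := f3_fill (t - m - 3) ltac:(lia).
have [t3|t3] := eqVneq t m.+3.
  rewrite t3 /= f3_record; move: fi; rewrite (_ : m + _ = m.+3); last lia.
  by move=> ->; lia.
have [fi' _] := f3_fill (t - m - 4) ltac:(lia).
move: fi fi'; rewrite (_ : m + (t - m - 3).+3 = t); last lia.
rewrite (_ : m + (t - m - 4).+3 = t.-1); last lia.
move=> -> ->; lia.
Qed.

End Step.

Lemma landing_cover t : 3 < t -> exists m,
  [/\ landing m, filled m & m.+2 <= t <= (jump m).+1].
Proof.
elim: t => // t IH; rewrite ltnS leq_eqVlt => /predU1P[<-|/IH[m [lm fm /andP[mt tm]]]].
  by exists 2; rewrite jump2; split=> //; [exact: landing2|exact: filled2].
have [tj|tj] := leqP t (jump m); first by exists m; split=> //; lia.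
have m1 : 1 < m by have /landingP[] := lm.
exists (jump m); split.
- exact: landing_jump.
- by apply: filled_jump => //; apply: landing_even.
- by have := ltn_jump (jump m); lia.
Qed.

(** Each [t > 3] lies in exactly one cycle of the sequence, between two
    consecutive landings, and such a cycle has one turning point, at its start. *)
Lemma recordsE r : records r <-> exists z, [/\ landing z, 3 < z & r = z.+1].
Proof.
have step m : landing m -> filled m -> 1 < m /\ ~~ odd m.
  by move=> lm _; split; [have /landingP[] := lm | exact: landing_even].
split=> [[t [[t3 tp]|[-> nl]] <-]|[z [lz z3 ->]]].
- have [m [lm fm tm]] := landing_cover _ t3; have [m1 me] := step _ lm fm.
  have tE := (turning_point_step _ m1 me fm _ tm).1 tp.
  exists (jump m); rewrite landing_jump // tE f3_record // jumpK; split=> //.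
  by have := gap_prime_even m ltac:(lia) me; have := jumpK m; lia.
- by case: nl; split=> // -[|[|k]] // [].
- have [m [lm fm /andP[mz zm]]] := landing_cover z.+1 ltac:(lia).
  have [m1 me] := step _ lm fm.
  have zE : z = jump m.
    apply/eqP; rewrite eqn_leq -ltnS zm /=.
    by have /landingP[_] := lz; apply; lia.
  exists m.+2; last by rewrite f3_record // zE jumpK.
  left; split; first lia.
  have tm : m.+2 <= m.+2 <= (jump m).+1 by rewrite leqnn ltnS ltn_jump.
  exact: (turning_point_step _ m1 me fm _ tm).2 erefl.
Qed.

(** * Counting up to a bound *)

Definition num_below P n := \sum_(0 <= z < n) P z.

Lemma num_below_le n P Q :
  (forall z, P z -> Q z) -> num_below P n <= num_below Q n.
Proof.
by move=> PQ; apply: leq_sum => z _; have := PQ z; case: (P z) => // ->.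
Qed.

Lemma num_below_leq P n : num_below P n <= n.
Proof.
rewrite -{2}(subn0 n) -[n - 0]muln1 -sum_nat_const_nat.
by apply: leq_sum => z _; apply: leq_b1.
Qed.

Lemma num_below_lt a n : num_below (fun z => z < a) n <= a.
Proof.
rewrite /num_below; have [na|an] := leqP n a.
  exact: leq_trans (num_below_leq _ _) na.
rewrite (big_cat_nat (n := a)) ?(ltnW an) //=.
rewrite [X in _ + X]big_nat_cond [X in _ + X]big1 => [|z /andP[/andP[az _] _]].
  by rewrite addn0 num_below_leq.
by rewrite ltnNge az.
Qed.

Lemma num_belowD P a b :
  num_below P (a + b) = num_below P a + num_below (fun z => P (a + z)) b.
Proof.
rewrite /num_below; elim: b => [|b IH].
  by rewrite addn0 [X in _ + X]big_geq // addn0.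
by rewrite addnS !big_nat_recr //= IH addnA.
Qed.

Lemma num_below_eq P Q n : P =1 Q -> num_below P n = num_below Q n.
Proof. by move=> PQ; apply: eq_bigr => z _; rewrite PQ. Qed.

Lemma num_below_periodic P p a b : (forall z, P (p + z) = P z) ->
  num_below P (a * p + b) = a * num_below P p + num_below P b.
Proof.
move=> Pp; elim: a => [|a IH]; first by rewrite !mul0n.
by rewrite !mulSn -!addnA num_belowD -IH; congr (_ + _); apply: num_below_eq.
Qed.

Lemma num_below_periodic_le P p n : 0 < p -> (forall z, P (p + z) = P z) ->
  num_below P n * p <= n * num_below P p + p * p /\
  n * num_below P p <= num_below P n * p + p * p.
Proof.
move=> p0 Pp; set a := n %/ p; set b := n %% p; have nE : n = a * p + b := divn_eq n p.
have bp : b < p := ltn_pmod n p0.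
rewrite nE num_below_periodic //; set C := num_below P p; set d := num_below P b.
have dp : d * p <= p * p.
  by rewrite leq_mul2r (leq_trans (num_below_leq P b) (ltnW bp)) orbT.
have bC : b * C <= p * p by rewrite leq_mul ?num_below_leq // ltnW.
rewrite !mulnDl -!mulnA [C * p]mulnC; lia.
Qed.

(** The first block of length [p] contributes nothing, which keeps the bound free
    of an additive error term; the bounds for infinitely many [p] can thus be
    summed. *)
Lemma num_below_residue_lt p c n : 0 < p ->
  num_below (fun z => (p <= z) && (z %% p < c)) n <= n %/ p * c.
Proof.
move=> p0; pose f := fun z => (p <= z) && (z %% p < c).
have mono x y : x <= y -> num_below f x <= num_below f y.
  by move=> xy; rewrite -(subnKC xy) num_belowD leq_addr.
apply: (@leq_trans (num_below f (p + (n %/ p * p + 0)))).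
  by apply: mono; rewrite {1}(divn_eq n p); have := ltn_pmod n p0; lia.
rewrite num_belowD (_ : num_below f p = 0); last first.
  rewrite /num_below big_nat_cond big1 // => z /andP[/andP[_ zp] _].
  by rewrite /f leqNgt zp.
rewrite (num_below_eq _ (fun z => z %% p < c)); last first.
  by move=> z; rewrite /f leq_addr modnDl.
rewrite num_below_periodic => [|z]; last by rewrite modnDl.
rewrite [X in _ + (_ + X)]/num_below big_geq // addn0 leq_mul2l; apply/orP; right.
apply: leq_trans (num_below_lt c p); apply: eq_leq.
by apply: eq_big_nat => z /andP[_ zp]; rewrite modn_small.
Qed.

Lemma sum_even a d : ~~ odd a -> \sum_(a <= z < a + d.*2) ~~ odd z = d.
Proof.
move=> ea; elim: d => [|d IH]; first by rewrite big_geq // addn0.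
rewrite doubleS !addnS big_nat_recr /=; last lia.
rewrite big_nat_recr /=; last lia.
by rewrite IH; lia.
Qed.

(** * A periodic sieve approximating the landings *)

(** [clear j z] says that no jump of length [p_(j+1) - 1] starting at the last
    multiple of [p_j#] before [z] passes over [z]. *)
Definition clear j z :=
  (primorial j %| z) || (nth_prime j.+1 <= (z %% primorial j).+1).

Fixpoint sieve k z := if k is k'.+1 then sieve k' z && clear k'.+1 z else true.

Lemma sieveP k z : reflect (forall j, 0 < j -> j <= k -> clear j z) (sieve k z).
Proof.
elim: k => [|k IH] /=; first by constructor=> -[].
apply: (iffP andP) => [[/IH s c] j j0|s]; last first.
  by split; [apply/IH => j j0 jk; apply: s => //; apply: leqW | apply: s].
by rewrite leq_eqVlt => /predU1P[->//|]; rewrite ltnS; apply: s.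
Qed.

Lemma clear_mod j p z : primorial j %| p -> clear j (z %% p) = clear j z.
Proof. by move=> jp; rewrite /clear /dvdn modn_dvdm. Qed.

Lemma sieve_mod k p z : primorial k %| p -> sieve k (z %% p) = sieve k z.
Proof.
move=> kp; apply/sieveP/sieveP => h j j0 jk; have := h j j0 jk;
  by rewrite clear_mod // (dvdn_trans (dvdn_primorial _ _ jk)).
Qed.

Lemma sieve_periodic k z : sieve k (primorial k + z) = sieve k z.
Proof. by rewrite -(sieve_mod k (primorial k)) // modnDl sieve_mod. Qed.

Definition period_count k := num_below (sieve k) (primorial k).

Lemma period_count3 : period_count 3 = 9.
Proof.
have [p1 p2 p3 p4] := nth_prime_1234; have [q1 q2 q3] := primorial_123.
rewrite /period_count q3 (num_below_eq _ (fun z => [&& (2 %| z) || (3 <= (z %% 2).+1),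
  (6 %| z) || (5 <= (z %% 6).+1) & (30 %| z) || (7 <= (z %% 30).+1)])).
  by rewrite /num_below unlock.
by move=> z; rewrite /= /clear p2 p3 p4 q1 q2 q3 -andbA.
Qed.

(** If [p - 1] had a residue [r] with [0 < r < p_(j+1) - 1] modulo [p_j#], a
    prime factor of [r + 1] would divide [p_j#], hence [p], although [p] is
    a prime beyond [p_j]. *)
Lemma sieve_next_prime k i : 0 < i -> k < i -> sieve k (nth_prime i).-1.
Proof.
case: i => // i _ ki; apply/sieveP => j j0 jk; rewrite /clear.
set p := nth_prime i.+1; have pp : prime p := nth_prime_prime i.
set r := p.-1 %% primorial j; rewrite -implyNb; apply/implyP => nd.
rewrite leqNgt; apply/negP => lt.
have r0 : 0 < r by rewrite lt0n.
have r1 : 1 < r.+1 by rewrite ltnS.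
have lp := pdiv_prime r1; have lr := pdiv_leq (ltnW r1).
have lj : pdiv r.+1 %| primorial j.
  by apply: prime_dvd_primorial => //; apply: leq_ltn_trans lr lt.
have : pdiv r.+1 %| p.
  have -> : p = p.-1 %/ primorial j * primorial j + r.+1.
    by rewrite addnS -divn_eq prednK // prime_gt0.
  by rewrite dvdn_add ?pdiv_dvd // dvdn_mull.
rewrite dvdn_prime2 // => /eqP E.
have : p <= nth_prime j by rewrite -E; apply: prime_dvd_primorial_le.
rewrite leqNgt => /negP; apply; apply: nth_prime_lt; lia.
Qed.

Lemma nth_prime_odd i : 1 < i -> odd (nth_prime i).
Proof.
case: i => [|[|i]] // _; have [E|//] := even_prime (nth_prime_prime i.+1).
have [p1 _ _ _] := nth_prime_1234; have := nth_prime_lt 1 i.+2 isT; lia.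
Qed.

Lemma sieve_even k z : 0 < k -> sieve k z -> ~~ odd z.
Proof.
move=> k0 /sieveP/(_ 1 isT k0); have [_ p2 _ _] := nth_prime_1234.
by have [q1 _ _] := primorial_123; rewrite /clear p2 q1; lia.
Qed.

(** A period of level [k + 1] consists of [p_(k+1)] periods of level [k], minus
    the numbers [z < p_(k+2) - 1] that survive level [k] and are killed by the
    multiple 0 of [p_(k+1)#].  As [p_(k+2) - 1 <= p_k#], such a [z] is its own
    residue modulo [p_k#], so surviving level [k] forces [p_(k+1) - 1 <= z].
    All survivors are even, whence the upper bound on the loss, and
    [p_(k+1) - 1] itself is lost. *)
Lemma period_count_loss k : 2 < k -> exists L,
  [/\ period_count k.+1 + L = nth_prime k.+1 * period_count k, 0 < L
    & 2 * L <= nth_prime k.+2 - nth_prime k.+1].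
Proof.
move=> k2; set p := nth_prime k.+1; set q := nth_prime k.+2.
have pq : p < q := nth_prime_ltS k.+1.
have p1 : 1 < p := prime_gt1 (nth_prime_prime k).
have op : odd p by apply: nth_prime_odd; lia.
have oq : odd q by apply: nth_prime_odd; lia.
have qP : q <= primorial k + 1.
  case: k k2 @p @q pq p1 op oq => // k k2 p q pq p1 op oq.
  have := nth_prime_le_primorial k k2; rewrite primorialS -/q.
  by have := prime_gt1 (nth_prime_prime k); nia.
have PP : primorial k <= primorial k.+1 by apply: primorial_le.
pose f z := sieve k z && ~~ clear k.+1 z.
exists (num_below f (primorial k.+1)); split.
- have -> : nth_prime k.+1 * period_count k = num_below (sieve k) (primorial k.+1).
    have := num_below_periodic _ _ p 0 (sieve_periodic k).
    rewrite !addn0 mulnC -primorialS => ->.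
    by rewrite [num_below _ 0]/num_below big_geq // addn0.
  rewrite /period_count /num_below -big_split /=; apply: eq_bigr => z _.
  by rewrite /f /=; case: sieve; case: clear.
- rewrite /num_below (big_cat_nat (n := p.-1)) //=; last lia.
  rewrite [X in _ + X]big_ltn; last lia.
  (* The loss is nonzero because it includes [p - 1]. *)
  suff fp : f p.-1 by rewrite addnCA fp.
  rewrite /f sieve_next_prime //= /clear negb_or -/q modn_small; last lia.
  by rewrite gtnNdvd; lia.
- have -> : q - p = (q - p)./2.*2 by lia.
  (* Compare the loss with the number of even integers in [p - 1, q - 1). *)
  rewrite mul2n leq_double -[X in _ <= X](@sum_even p.-1); last lia.
  have -> : p.-1 + (q - p)./2.*2 = q.-1 by lia.
  have f0 z : z < primorial k.+1 -> f z -> p.-1 <= z < q.-1 /\ ~~ odd z.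
    move=> zP /andP[sz]; rewrite /clear negb_or -/q modn_small // => /andP[nd zq].
    split; last by apply: sieve_even sz; lia.
    have := elimT (sieveP _ _) sz k ltac:(lia) (leqnn k).
    rewrite /clear -/p modn_small; last lia.
    case/orP => [kz|]; last lia.
    case: (posnP z) nd => [->|z0 _]; first by rewrite dvdn0.
    have := dvdn_leq z0 kz; lia.
  rewrite /num_below (big_cat_nat (n := p.-1)) //=; last lia.
  rewrite big_nat_cond big1 ?add0n => [|z /andP[/andP[_ zp] _]]; last first.
    by case fz: (f z) => //; have [] := f0 z ltac:(lia) fz; lia.
  rewrite (big_cat_nat (n := q.-1)) //=; [|lia|lia].
  rewrite [X in _ + X]big_nat_cond [X in _ + X]big1 ?addn0
    => [|z /andP[/andP[qz zP] _]]; last first.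
    by case fz: (f z) => //; have [] := f0 z ltac:(lia) fz; lia.
  rewrite big_nat_cond [X in _ <= X]big_nat_cond.
  apply: leq_sum => z /andP[/andP[pz zq] _].
  by case fz: (f z) => //; have [_ ->] := f0 z ltac:(lia) fz.
Qed.

(** * Comparing records with the sieve *)

(** Below [p_k#] the two notions differ, because the sieve also lets 0 jump. *)
Lemma landing_sieve k z : landing z -> primorial k <= z -> sieve k z.
Proof.
move=> /landingP[z1 h] kz; apply/sieveP => j j0 jk; rewrite /clear -implyNb.
apply/implyP => nd; set r := z %% primorial j.
have r0 : 0 < r by rewrite lt0n.
pose m := z %/ primorial j * primorial j.
have zE : z = m + r := divn_eq z (primorial j).
have m0 : 0 < m.
  rewrite muln_gt0 primorial_gt0 divn_gt0 ?primorial_gt0 // andbT.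
  exact: leq_trans (primorial_le _ _ jk) kz.
have mz : m < z by rewrite [z in _ < z]zE -[X in X < _]addn0 ltn_add2l.
have := h m m0 mz; have := jumpK m.
have := primorial_dvd_gap_prime j m m0 (dvdn_mull _ (dvdnn _)); lia.
Qed.

(** Let the jump of [m] pass over [z], and let [j] be its level.  If [j <= k], then
    [z] must be a multiple of [p_j#] to survive the sieve, so [p_j#] divides
    [z - m]; but [z - m + 1] is smaller than [p_(j+1)] and so shares a prime
    factor with [p_j#]. *)
Lemma sieve_not_landing k n z : z < n -> 1 < z -> sieve k z -> ~~ landing z ->
  exists j, [/\ k < j < n, primorial j <= z & z %% primorial j < nth_prime j.+1].
Proof.
move=> zn z1 sz; rewrite /landing z1 /= negb_forall => /existsP[[m mz] /=].
rewrite negb_imply -ltnNge => /andP[m0]; rewrite -ltnS jumpK => zq.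
set j := gap_index m; have jm : primorial j %| m := primorial_gap_index m.
have qE : gap_prime m = nth_prime j.+1 by [].
have zr : z %% primorial j <= z - m.
  by case/dvdnP: jm => c mE; rewrite -{1}(subnKC (ltnW mz)) {1}mE modnMDl leq_mod.
have jz : primorial j <= m by apply: dvdn_leq.
have zq' : z - m < (gap_prime m).-1 by lia.
have lt : (z %% primorial j).+1 < nth_prime j.+1.
  by rewrite -qE; apply: leq_ltn_trans (_ : (z - m).+1 < _); lia.
exists j; split; [|exact: leq_trans jz (ltnW mz)|exact: ltnW].
rewrite (leq_trans (primorial_ge j)) ?(leq_trans jz) ?(ltnW (ltn_trans mz zn)) // andbT.
rewrite ltnNge; apply/negP => jk.
have j0 : 0 < j.
  rewrite lt0n; apply/eqP => j0; have [p1 _ _ _] := nth_prime_1234.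
  by move: qE; rewrite j0 p1; lia.
have := elimT (sieveP _ _) sz j j0 jk; rewrite /clear => /orP[jdz|]; last lia.
have jd : primorial j %| z - m by rewrite dvdn_sub.
have d1 : 1 < (z - m).+1 by lia.
have pd : pdiv (z - m).+1 %| z - m.
  apply: dvdn_trans jd; apply: prime_dvd_primorial; first exact: pdiv_prime.
  by apply: leq_ltn_trans (pdiv_leq (ltnW d1)) _; lia.
have : pdiv (z - m).+1 %| 1.
  by rewrite -(dvdn_addr _ pd) addn1 pdiv_dvd.
by rewrite dvdn1 => /eqP E; have := pdiv_prime d1; rewrite E.
Qed.

Lemma num_below_landing_le k n :
  num_below landing n <= num_below (sieve k) n + primorial k.
Proof.
apply: leq_trans (leq_add (leqnn _) (num_below_lt (primorial k) n)).
rewrite /num_below -big_split; apply: leq_sum => z _ /=.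
case lz: (landing z) => //.
case: (leqP (primorial k) z) => kz; last by rewrite addn1.
by rewrite (landing_sieve k).
Qed.

Lemma num_below_sieve_le k n : num_below (sieve k) n <=
  num_below landing n + 2
  + \sum_(k.+1 <= j < n) n %/ primorial j * nth_prime j.+1.
Proof.
pose hit j z := (primorial j <= z) && (z %% primorial j < nth_prime j.+1).
apply: (@leq_trans (num_below landing n + num_below (fun z => z < 2) n
    + \sum_(k.+1 <= j < n) num_below (hit j) n)); last first.
  apply: leq_add; first by rewrite leq_add2l num_below_lt.
  by apply: leq_sum => j _; apply: num_below_residue_lt; apply: primorial_gt0.
rewrite /num_below exchange_big /= -!big_split big_nat_cond [X in _ <= X]big_nat_cond.
apply: leq_sum => z /andP[/andP[_ zn] _] /=.
case sz: (sieve k z) => //; case lz: (landing z) => //.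
case: (ltnP z 2) => [//|z1]; rewrite !add0n.
have [j [kjn jz zr]] := sieve_not_landing k n z zn z1 sz (negbT lz).
rewrite (bigD1_seq j) ?mem_index_iota ?iota_uniq //=.
by rewrite /hit jz zr.
Qed.

Lemma record_countE n :
  record_count n = num_below (fun z => landing z && (3 < z)) n.
Proof.
rewrite /record_count -sum1_card big_mkcond /=.
rewrite -(big_mkord xpredT (fun r => if r \in records then 1 else 0)).
rewrite big_nat_recl //.
have recE z : (z.+1 \in records) = landing z && (3 < z).
  apply/idP/idP => [|/andP[lz z3]].
    by rewrite in_setE => /recordsE[w [lw w3 [->]]]; rewrite lw.
  by rewrite in_setE; apply/recordsE; exists z.
have -> : (0 \in records) = false.
  by apply/negP; rewrite in_setE => /recordsE[z []].
rewrite add0n; apply: eq_bigr => z _; rewrite recE; by case: (_ && _).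
Qed.

(** The landing 2 is the only one that does not give a record; the crude error 4
    is enough for a density. *)
Lemma record_count_landing n :
  record_count n <= num_below landing n /\ num_below landing n <= record_count n + 4.
Proof.
rewrite record_countE; split; first by apply: num_below_le => z /andP[].
apply: leq_trans (leq_add (leqnn _) (num_below_lt 4 n)).
rewrite /num_below -big_split; apply: leq_sum => z _ /=.
by case: (landing z) => //; case: (ltnP 3 z) => // z3; rewrite ltnS z3.
Qed.

End Records.

(** * Densities and limits *)

Section Limits.
Variable R : realType.
Implicit Types (i j k n : nat).

Definition density k : R := (period_count k)%:R / (primorial k)%:R.

Lemma primorial_gt0R k : 0 < (primorial k)%:R :> R.
Proof. by rewrite ltr0n primorial_gt0. Qed.

Lemma nth_prime_gt0R k : 0 < (nth_prime k.+1)%:R :> R.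
Proof. by rewrite ltr0n prime_gt0 // nth_prime_prime. Qed.

Lemma density3 : density 3 = 3 / 10.
Proof.
by rewrite /density period_count3; have [_ _ ->] := primorial_123; field.
Qed.

Lemma density_ge0 k : 0 <= density k.
Proof. by rewrite divr_ge0. Qed.

Lemma density_step k : (2 < k)%N ->
  1 / (primorial k.+1)%:R <= density k - density k.+1 <=
  ((nth_prime k.+2)%:R - (nth_prime k.+1)%:R) / (2 * (primorial k.+1)%:R).
Proof.
move=> /period_count_loss[L [cE L0 L2]].
have P0 := primorial_gt0R k; have p0 := nth_prime_gt0R k.
have P1 := primorial_gt0R k.+1.
have -> : density k - density k.+1 = L%:R / (primorial k.+1)%:R.
  have cR : (period_count k.+1)%:R
      = (nth_prime k.+1)%:R * (period_count k)%:R - L%:R :> R.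
    by rewrite -natrM -cE natrD addrK.
  rewrite /density cR primorialS natrM; field.
  by rewrite !gt_eqF.
rewrite invfM mulrA !ler_pM2r ?invr_gt0 // ler1n L0 /=.
have : (2 * L + nth_prime k.+1)%:R <= (nth_prime k.+2)%:R :> R.
  by rewrite ler_nat; have := nth_prime_ltS k.+1; lia.
rewrite natrD natrM; lra.
Qed.

(** The bound on [p_(i+3)] cancels [p_i#] and leaves the reciprocal of a product of
    two consecutive primes, which is dominated by a telescoping difference. *)
Lemma jump_density_le i : (1 < i)%N ->
  (nth_prime i.+3)%:R / (primorial i.+2)%:R
  <= 3 / (nth_prime i.+1)%:R - 3 / (nth_prime i.+2)%:R :> R.
Proof.
move=> i1; have P0 := primorial_gt0R i.
have p0 := nth_prime_gt0R i; have q0 := nth_prime_gt0R i.+1.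
have pq : (nth_prime i.+1)%:R + 1 <= (nth_prime i.+2)%:R :> R.
  by rewrite natr1 ler_nat nth_prime_ltS.
have le3 : (nth_prime i.+3)%:R <= 3 * (primorial i)%:R :> R.
  rewrite -natrM ler_nat; apply: leq_trans (nth_prime_le_primorial i i1) _.
  by have := primorial_gt0 i; lia.
rewrite !primorialS !natrM.
move: (nth_prime i.+1)%:R (nth_prime i.+2)%:R (nth_prime i.+3)%:R (primorial i)%:R
  P0 p0 q0 pq le3 => p q r P P0 p0 q0 pq le3.
rewrite ler_pdivrMr ?mulr_gt0 //.
have -> : (3 / p - 3 / q) * (P * p * q) = 3 * P * (q - p).
  by field; rewrite !gt_eqF.
apply: le_trans le3 _; rewrite ler_peMr //; last lra.
by rewrite mulr_ge0 // ltW.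
Qed.

Lemma sum_jump_density_le k n : (2 < k)%N ->
  \sum_(k.+1 <= j < n) (nth_prime j.+1)%:R / (primorial j)%:R
  <= 3 / (nth_prime k)%:R :> R.
Proof.
case: k => [|[|[|i]]] // _; set k := i.+3.
suff : \sum_(k.+1 <= j < n) (nth_prime j.+1)%:R / (primorial j)%:R
    <= \sum_(k.+1 <= j < n)
         - (3 / (nth_prime j)%:R - 3 / (nth_prime j.-1)%:R) :> R.
  move=> /le_trans; apply; have [nk|kn] := leqP n k.+1.
    by rewrite big_geq // divr_ge0.
  case: n kn => // n kn; rewrite sumrN big_add1 /= telescope_sumr; last exact: ltnW.
  by rewrite opprB lerBlDr lerDl divr_ge0.
rewrite big_nat_cond [leRHS]big_nat_cond.
apply: ler_sum => -[|[|j]] // /andP[/andP[kj _] _].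
by rewrite opprB; apply: jump_density_le; rewrite /k in kj; lia.
Qed.

(** The error is a constant depending on [k] plus a small multiple of [n], so it
    controls the density once [k] is large and [n] is large compared with [k]. *)
Lemma record_count_approx k n : (2 < k)%N ->
  `|(record_count n)%:R - n%:R * density k|
  <= (2 * primorial k + 6)%N%:R + n%:R * (3 / (nth_prime k)%:R).
Proof.
move=> k2; have P0 := primorial_gt0R k.
have [le1 le2] := record_count_landing n.
have le3 := num_below_landing_le k n; have le4 := num_below_sieve_le k n.
have [le5 le6] := num_below_periodic_le _ _ n (primorial_gt0 k) (sieve_periodic k).
set T := num_below (sieve k) n in le3 le4 le5 le6.
have d1 : T%:R <= n%:R * density k + (primorial k)%:R.
  rewrite -(ler_pM2r P0) mulrDl -mulrA /density divfK ?gt_eqF //.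
  by rewrite -!natrM -natrD ler_nat.
have d2 : n%:R * density k <= T%:R + (primorial k)%:R.
  rewrite -(ler_pM2r P0) mulrDl -mulrA /density divfK ?gt_eqF //.
  by rewrite -!natrM -natrD ler_nat.
have d3 : (\sum_(k.+1 <= j < n) n %/ primorial j * nth_prime j.+1)%:R
    <= n%:R * (3 / (nth_prime k)%:R) :> R.
  apply: le_trans (ler_wpM2l (ler0n _ _) (sum_jump_density_le k n k2)).
  rewrite natr_sum mulr_sumr; apply: ler_sum => j _.
  rewrite natrM mulrCA mulrC ler_wpM2l // ler_pdivlMr ?primorial_gt0R //.
  by rewrite -natrM ler_nat leq_trunc_div.
have e0 : 0 <= n%:R * (3 / (nth_prime k)%:R) :> R by rewrite mulr_ge0 ?divr_ge0.
have := leq_trans le1 le3.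
have := leq_trans le4 (leq_add (leq_add le2 (leqnn 2)) (leqnn _)).
rewrite -!(ler_nat R) !natrD => a1 a2.
by rewrite ler_norml; apply/andP; split; lra.
Qed.

Lemma cvg_by_approx (u d e K : nat -> R) (l : R) :
  (forall k n, (2 < k)%N -> (0 < n)%N -> `|u n - d k| <= K k / n%:R + e k) ->
  d @ \oo --> l -> e @ \oo --> 0 -> u @ \oo --> l.
Proof.
move=> H dl e0; apply/cvgrPdist_le => eps eps0.
have e4 : 0 < eps / 3 by lra.
have [k [k2 dk ek]] : exists k,
    [/\ (2 < k)%N, `|l - d k| <= eps / 3 & `|0 - e k| <= eps / 3].
  have /cvgrPdist_le/(_ _ e4)[N1 _ h1] := e0.
  have /cvgrPdist_le/(_ _ e4)[N2 _ h2] := dl.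
  exists (maxn 3 (maxn N1 N2)); split; first by lia.
    by apply: h2 => /=; lia.
  by apply: h1 => /=; lia.
have Kn : (fun n => K k / n%:R) @ \oo --> (0 : R).
  rewrite -[X in _ --> X](mulr0 (K k)); apply: cvgMr.
  apply/gtr0_cvgV0; last exact: cvgr_idn.
  by exists 1%N => // n /= n0; rewrite ltr0n.
have /cvgrPdist_le/(_ _ e4)[N _ hN] := Kn.
exists (maxn 1 N) => // n /= nN; have n0 : (0 < n)%N by lia.
have := H k n k2 n0; have := hN n ltac:(rewrite /=; lia).
move: dk ek; rewrite !ler_norml; lra.
Qed.

Lemma cvg_inv_nth_prime : (3 / (nth_prime k)%:R : R) @[k --> \oo] --> 0.
Proof.
rewrite -[X in _ --> X](mulr0 3); apply: cvgMr.
apply/gtr0_cvgV0.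
  by exists 1%N => // -[//|k] _; apply: nth_prime_gt0R.
apply: ger_cvgy cvgr_idn; near=> k.
by rewrite ler_nat nth_prime_ge.
Unshelve. all: by end_near. Qed.

End Limits.

Theorem theorem2p12 (R : realType) :
  let lower := fun k : nat =>
    ((nth_prime k.+1)%:R - (nth_prime k)%:R) / (2 * (primorial k)%:R) : R in
  let upper := fun k : nat => 1 / (primorial k)%:R : R in
  cvgn (fun n : nat => \sum_(4 <= k < n) lower k) /\
  cvgn (fun n : nat => \sum_(4 <= k < n) upper k) /\
  exists kappa : R,
    (fun n : nat => (record_count n)%:R / n%:R : R) @ \oo --> kappa /\
    3 / 10 - \big[+%R/0]_(4 <= k <oo) lower k <= kappa /\
    kappa <= 3 / 10 - \big[+%R/0]_(4 <= k <oo) upper k.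
Proof.
move=> lower upper.
have step k : (2 < k)%N ->
  upper k.+1 <= density R k - density R k.+1 <= lower k.+1 := @density_step R k.
have upper_ge0 k : 0 <= upper k by rewrite divr_ge0.
have lower_ge0 k : 0 <= lower k.
  by rewrite divr_ge0 ?mulr_ge0 // subr_ge0 ler_nat ltnW ?nth_prime_ltS.
have sums n : (2 < n)%N -> \sum_(4 <= k < n.+1) upper k
    <= 3 / 10 - density R n <= \sum_(4 <= k < n.+1) lower k.
  move=> n2; rewrite -(subnKC n2); elim: (n - 3)%N => [|m IH].
    by rewrite addn0 !big_geq // density3 subrr lexx.
  rewrite addnS; have := step (3 + m)%N isT; move: IH => /andP[IH1 IH2] /andP[s1 s2].
  have recr (f : nat -> R) : \sum_(4 <= k < (3 + m).+2) f k
      = \sum_(4 <= k < (3 + m).+1) f k + f (3 + m).+1 by rewrite big_nat_recr.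
  by rewrite !recr; apply/andP; split; lra.
(* The estimates hold from level 3 on, so [d] starts there. *)
pose d n := density R (n + 3).
have d_noninc : nonincreasing_seq d.
  apply/nonincreasing_seqP => n; rewrite /d addSn.
  have /andP[+ _] := step (n + 3)%N ltac:(lia); have := upper_ge0 (n + 3).+1; lra.
have d_cvg : cvgn d.
  apply: nonincreasing_is_cvgn => //.
  by exists 0 => _ [n _ <-]; apply: density_ge0.
have kappa_le n : (2 < n)%N -> limn d <= density R n.
  move=> n2; rewrite -(subnK n2); exact: nonincreasing_cvgn_ge.
have nd (f : nat -> R) : (forall k, 0 <= f k) ->
    nondecreasing_seq (fun n => \sum_(4 <= k < n) f k).
  move=> f0; apply/nondecreasing_seqP => n; have [n4|n4] := leqP 4 n.
    by rewrite big_nat_recr //= lerDl.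
  by rewrite !big_geq //; lia.
have cvg_bounded (f : nat -> R) M : (forall k, 0 <= f k) ->
    (forall n, \sum_(4 <= k < n) f k <= M) ->
    cvgn (fun n => \sum_(4 <= k < n) f k).
  move=> f0 fM; apply: nondecreasing_is_cvgn; first exact: nd.
  by exists M => _ [n _ <-].
have upper_le n : \sum_(4 <= k < n) upper k <= 3 / 10 - limn d.
  have [n4|n4] := leqP 4 n.
    have -> : n = n.-1.+1 by lia.
    have n2 : (2 < n.-1)%N by lia.
    by have := kappa_le _ n2; have /andP[+ _] := sums _ n2; lra.
  rewrite big_geq //; last exact: ltnW.
  by have := kappa_le 3 isT; rewrite density3; lra.
have upper_cvg := cvg_bounded upper _ upper_ge0 upper_le.
have lower_cvg : cvgn (fun n => \sum_(4 <= k < n) lower k).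
  apply: (cvg_bounded _ (3 / (nth_prime 3)%:R)) => // n.
  apply: le_trans (sum_jump_density_le R 3 n isT); apply: ler_sum => k _.
  have P0 := primorial_gt0R R k.
  rewrite ler_pM ?invr_ge0 ?mulr_ge0 ?lef_pV2 ?posrE ?mulr_gt0 //.
  - by rewrite subr_ge0 ler_nat ltnW ?nth_prime_ltS.
  - by rewrite lerBlDr lerDl.
  - by rewrite ler_peMl ?ler1n // ltW.
split=> //; split=> //; exists (limn d); split.
  have dl : density R @ \oo --> limn d by rewrite -(cvg_shiftn 3).
  apply: (cvg_by_approx _ _ _ _ (fun k => (2 * primorial k + 6)%N%:R) _ _
    dl (cvg_inv_nth_prime R)).
  move=> k n k2 n0; have n0R : 0 < n%:R :> R by rewrite ltr0n.
  have := record_count_approx R k n k2.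
  have -> : (record_count n)%:R / n%:R - density R k
      = ((record_count n)%:R - n%:R * density R k) / n%:R by field; rewrite gt_eqF.
  rewrite normrM [`|n%:R^-1|]gtr0_norm ?invr_gt0 // ler_pdivrMr //.
  by rewrite [X in _ -> _ <= X]mulrDl divfK ?gt_eqF // [X in _ -> _ <= _ + X]mulrC.
split.
  apply: limr_ge => //; near=> n; rewrite lerBlDr -lerBlDl.
  have n2 : (2 < n + 3)%N by lia.
  have /andP[_ /le_trans] := sums _ n2; apply.
  exact: nondecreasing_cvgn_le (nd _ lower_ge0) lower_cvg _.
rewrite lerBrDr -lerBrDl; apply: limr_le => //; near=> n; exact: upper_le.
Unshelve. all: by end_near. Qed.
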